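(* One has $\mathscr{M}_{n,d}=\frac{\log d}{\pi}+O(\log\log d)$ provided that $n\asymp \frac{d}{\log d}$; that is, for all real constants $0<c_1\le c_2$ there exist constants $C>0$ and $d_0\ge 3$ such that for all integers $d\ge d_0$ and all integers $n$ with $0\le n<d$ and $c_1\frac{d}{\log d}\le n\le c_2\frac{d}{\log d}$, $$\left|\mathscr{M}_{n,d}-\frac{\log d}{\pi}\right|\le C\log\log d.$$
   Context: For a function $f$ on the open complex unit disk $\mathbb{D}$, $\|f\|_\infty=\sup\{|f(z)|: z\in\mathbb{D}\}$. For integers $d>n\ge 0$, $\mathscr{M}_{n,d}$ denotes the maximum of $|a_0+a_1+\dots+a_n|$ over all polynomials $f=a_0+a_1X+\dots+a_{d-1}X^{d-1}\in\mathbb{C}[X]$ of degree strictly less than $d$ with $\|f\|_\infty\le 1$. Here $\log$ is the natural logarithm. *)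

(* Defs.v *)
From HB Require Import structures.
From mathcomp Require Import all_boot all_order all_algebra.
From mathcomp Require Import all_classical all_reals all_analysis.
From mathcomp Require Import complex.

Set Implicit Arguments.
Unset Strict Implicit.
Unset Printing Implicit Defensive.

Import Order.TTheory GRing.Theory Num.Theory.
Import numFieldNormedType.Exports.

Local Open Scope classical_set_scope.
Local Open Scope ring_scope.

(* [normc] is the real-valued modulus on [R[i]]; the generic [`|z|] takes its
   values in [R[i]]. *)
Notation normc := ComplexField.Normc.normc.

Definition unit_disk {R : realType} : set R[i] := [set z | normc z < 1].

(* Valued in [\bar R], so that an unbounded function has norm [+oo]. *)
Definition sup_norm (R : realType) (f : R[i] -> R[i]) : \bar R :=
  ereal_sup [set (normc (f z))%:E | z in unit_disk].

(* [size f <= d] means degree < d, the zero polynomial included. *)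
Definition partial_sums (R : realType) (n d : nat) : set R :=
  [set normc (\sum_(0 <= k < n.+1) f`_k) |
    f in [set f : {poly R[i]} |
      (size f <= d)%N /\ (sup_norm (fun z => f.[z]) <= 1%:E)%E]].

Arguments partial_sums R n d : clear implicits.

(* For n < d this supremum is a maximum: see [max_partial_sumP]. *)
Definition max_partial_sum (R : realType) (n d : nat) : R :=
  sup (partial_sums R n d).

Section MaximumAttained.
Variable R : realType.
Implicit Types (z : R[i]) (f : {poly R[i]}).

Lemma normr_normc z : `|z| = (normc z)%:C%C.
Proof. by case: z. Qed.

Lemma ge_sup_norm (g : R[i] -> R[i]) (M : R) :
  (sup_norm g <= M%:E)%E <-> (forall z, normc z < 1 -> normc (g z) <= M).
Proof.
split=> [h z z1|h].
  by rewrite -lee_fin; apply: le_trans h; apply: ereal_sup_ubound; exists z.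
by apply: ge_ereal_sup => _ [z z1 <-]; rewrite lee_fin h.
Qed.

Variable d : nat.

(* Polynomials of degree < d, with real and imaginary parts of the
   coefficients as real coordinates. *)
Let coefv (v : 'rV[R]_(d + d)) (k : 'I_d) : R[i] :=
  Complex (v ord0 (lshift d k)) (v ord0 (rshift d k)).

Let polyv v : {poly R[i]} := \sum_(k < d) coefv v k *: 'X^k.

Let linv (w : 'I_d -> R[i]) v : R[i] := \sum_(k < d) coefv v k * w k.

Let size_polyv v : (size (polyv v) <= d)%N.
Proof.
apply: leq_trans (size_sum _ _ _) _; apply/bigmax_leqP => k _.
by apply: leq_trans (size_scale_leq _ _) _; rewrite size_polyXn.
Qed.

Let horner_polyv v z : (polyv v).[z] = linv (fun k => z ^+ k) v.
Proof. by rewrite horner_sum; apply: eq_bigr => k _; rewrite !hornerE. Qed.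

Let coef_polyv v (k : 'I_d) : (polyv v)`_k = coefv v k.
Proof.
rewrite coef_sum (bigD1 k)//= coefZ coefXn eqxx mulr1 big1 ?addr0// => j jk.
by rewrite coefZ coefXn eq_sym (inj_eq val_inj) (negbTE jk) mulr0.
Qed.

Let polyv_surj f : (size f <= d)%N -> exists v, f = polyv v.
Proof.
move=> fd; exists (row_mx (\row_(k < d) complex.Re f`_k)
                          (\row_(k < d) complex.Im f`_k)).
apply/polyP => i; have [id|di] := ltnP i d; last first.
  by rewrite !nth_default// (leq_trans _ di)// size_polyv.
rewrite (coef_polyv _ (Ordinal id)) /coefv.
by rewrite row_mxEl row_mxEr !mxE /=; case: f`_i.
Qed.

Let normc_linv_continuous w : continuous (fun v => normc (linv w v)).
Proof.
have -> : (fun v => normc (linv w v)) = fun v =>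
    Num.sqrt ((\sum_(k < d) (v ord0 (lshift d k) * complex.Re (w k)
                      - v ord0 (rshift d k) * complex.Im (w k))) ^+ 2
      + (\sum_(k < d) (v ord0 (lshift d k) * complex.Im (w k)
                      + v ord0 (rshift d k) * complex.Re (w k))) ^+ 2).
  apply/funext => v; rewrite /linv.
  set S := (\sum_(k < d) coefv v k * w k).
  have -> : normc S = Num.sqrt (complex.Re S ^+ 2 + complex.Im S ^+ 2).
    by case: S.
  rewrite /S !raddf_sum /=.
  by congr (Num.sqrt (_ ^+ 2 + _ ^+ 2)); apply: eq_bigr => k _;
    case: (w k) => a b.
have c i (a : R) : continuous (fun v : 'rV[R]_(d + d) => v ord0 i * a).
  move=> v; apply: (@continuousM R _ (fun v : 'rV[R]_(d + d) => v ord0 i)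
    (fun=> a)); [exact: coord_continuous|exact: cst_continuous].
have cX (F : 'I_d -> 'rV[R]_(d + d) -> R) : (forall k, continuous (F k)) ->
    continuous (fun v => (\sum_(k < d) F k v) ^+ 2).
  move=> Fc v.
  have h : continuous (fun v => \sum_(k < d) F k v).
    by apply: continuous_big => [|k _]; [exact: add_continuous|exact: Fc].
  exact: (continuousM (h v) (h v)).
move=> v; apply: continuous_comp; last exact: sqrt_continuous.
by apply: continuousD; apply: cX => k u; [apply: (continuousB (c _ _ u) (c _ _ u))
  |apply: (continuousD (c _ _ u) (c _ _ u))].
Qed.

Let ballv := [set v | forall z, normc z < 1 -> normc (polyv v).[z] <= 1].

Let ballv_closed : closed ballv.
Proof.
have -> : ballv = \bigcap_(z in unit_disk)
    ((fun v => normc (linv (fun k : 'I_d => z ^+ k) v)) @^-1` [set x | x <= 1]).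
  by apply/seteqP; split => v /= h z /h; rewrite horner_polyv.
apply: closed_bigI => z _; apply: closed_comp; last exact: closed_le.
by move=> v _; exact: normc_linv_continuous.
Qed.

(* Lagrange interpolation at d distinct points of the disk. *)
Let ballv_bounded : bounded_set ballv.
Proof.
pose x : 'rV[R[i]]_d := \row_j ((j%:R / d%:R : R)%:C)%C.
pose V := Vandermonde d x.
have Vu : V \in unitmx.
  rewrite unitmxE det_Vandermonde unitfE.
  apply/prodf_neq0 => i _; apply/prodf_neq0 => j ij.
  rewrite !mxE subr_eq0; apply/eqP => -[] /eqP.
  have d0 : (d%:R : R) != 0.
    by rewrite pnatr_eq0 -lt0n; exact: leq_ltn_trans (ltn_ord i).
  by rewrite (inj_eq (mulIf (invr_neq0 d0))) eqr_nat gtn_eqF.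
pose M : R := \sum_i \sum_j normc (invmx V i j).
exists M; split; first exact: num_real.
move=> y My v vB; apply: le_trans (ltW My).
have Mge0 : 0 <= M.
  by do 2!(apply: sumr_ge0 => ? _); case: (invmx V _ _) => *; exact: sqrtr_ge0.
have cM k : normc (coefv v k) <= M.
  pose c : 'rV[R[i]]_d := \row_k coefv v k.
  have E : c = (c *m V) *m invmx V by rewrite mulmxK.
  have -> : coefv v k = c ord0 k by rewrite mxE.
  rewrite E mxE -lecR -normr_normc; apply: le_trans (ler_norm_sum _ _ _) _.
  rewrite /M rmorph_sum/=; apply: ler_sum => j _.
  rewrite normrM rmorph_sum/= (bigD1 k)//= -normr_normc.
  apply: (@le_trans _ _ `|invmx V j k|); last first.
    by rewrite lerDl sumr_ge0// => i _; rewrite -normr_normc.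
  rewrite ler_piMl// normr_normc lecR.
  have -> : (c *m V) ord0 j = (polyv v).[x ord0 j].
    by rewrite horner_polyv mxE; apply: eq_bigr => i _; rewrite !mxE.
  apply: vB; rewrite mxE /= expr0n/= addr0 sqrtr_sqr ger0_norm ?divr_ge0//.
  have d0 : (0 < d)%N by exact: leq_ltn_trans (ltn_ord j).
  by rewrite ltr_pdivrMr ?ltr0n// mul1r ltr_nat.
rewrite [leLHS]/Num.norm /= mx_normrE; apply/bigmax_leP; split => // -[i j] _ /=.
rewrite (ord1 i); case: (split_ordP j) => k ->.
  apply: le_trans (cM k); rewrite -sqrtr_sqr /coefv /= ler_wsqrtr//.
  by rewrite lerDl sqr_ge0.
apply: le_trans (cM k); rewrite -sqrtr_sqr /coefv /= ler_wsqrtr//.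
by rewrite lerDr sqr_ge0.
Qed.

Lemma max_partial_sumP (n : nat) : (n < d)%N ->
  partial_sums R n d (max_partial_sum R n d) /\
  ubound (partial_sums R n d) (max_partial_sum R n d).
Proof.
move=> nd; pose w (k : 'I_d) : R[i] := (k < n.+1)%:R.
have sumE v : \sum_(0 <= k < n.+1) (polyv v)`_k = linv w v.
  rewrite big_mkord /linv (big_ord_widen d (fun k => (polyv v)`_k) nd).
  rewrite big_mkcond/=; apply: eq_bigr => k _; rewrite coef_polyv /w.
  by case: ifP => _; rewrite ?mulr1 ?mulr0.
have b0 : ballv !=set0.
  exists 0 => z _; have -> : polyv 0 = 0.
    by apply: big1 => k _; rewrite /coefv !mxE scale0r.
  by rewrite horner0 ComplexField.Normc.normc0.
have [v vB vmax] : exists2 v, v \in ballv & forall t, t \in ballv ->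
    normc (linv w t) <= normc (linv w v).
  apply: compact_EVT_max b0 _ _; first exact: bounded_closed_compact.
  by apply: continuous_subspaceT; exact: normc_linv_continuous.
have mem : partial_sums R n d (normc (linv w v)).
  exists (polyv v); rewrite ?sumE//; split => //.
  by apply/ge_sup_norm; exact: set_mem vB.
have ub : ubound (partial_sums R n d) (normc (linv w v)).
  move=> _ [f [/polyv_surj[u ->] /ge_sup_norm fB] <-]; rewrite sumE.
  by apply: vmax; exact: mem_set.
suff -> : max_partial_sum R n d = normc (linv w v) by [].
apply/eqP; rewrite eq_le; apply/andP; split.
  by apply: ge_sup => //; exists (normc (linv w v)).
by apply: ub_le_sup => //; exists (normc (linv w v)).
Qed.

End MaximumAttained.

(* Main.v *)
Require Import Defs.
From HB Require Import structures.
From mathcomp Require Import all_boot all_order all_algebra.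
From mathcomp Require Import all_classical all_reals all_analysis.
From mathcomp Require Import cyclic separable cyclotomic complex ring lra.

Set Implicit Arguments.
Unset Strict Implicit.
Unset Printing Implicit Defensive.

Import Order.TTheory GRing.Theory Num.Theory.
Import numFieldNormedType.Exports.

Local Open Scope ring_scope.

(** Let c_k = binom(2k, k) / 4^k be the Taylor coefficients of (1 - z)^(-1/2)
    and G_n = c_0^2 + ... + c_n^2 Landau's constant.  The theorem follows from
      G_n (1 - 2n/d) <= M_(n,d) <= G_n      ([max_partial_sum_bounds])
    and G_n = (log n)/pi + O(1)  ([landau_const_ge], [landau_const_le]):
    when n is of order d / log d, the factor 1 - 2n/d costs O(1) because
    G_n = O(log d), and log n = log d - log log d + O(1).

    All the bounds on polynomials come from one inequality,
    [norm_coef_mul_sqr]: if |f| <= M on the unit circle, then every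
    coefficient of f g^2 is at most M times the sum of the |g_k|^2.  Indeed
    such a coefficient is an average of f g^2 against a unimodular factor, and
    the average of |g|^2 is the sum of the |g_k|^2.  Averaging over N-th roots
    of unity, with N large, is exact on polynomials and replaces integration.

    Upper bound (Landau).  Let P be the degree n Taylor polynomial of
    (1 - z)^(-1/2).  As P^2 = 1 + z + ... + z^n up to higher terms,
    a_0 + ... + a_n is the coefficient of z^n in f P^2; take g = P.

    Lower bound.  Landau's extremal function is Q / P, where
    Q(z) = z^n P(1/z) has the modulus of P on the circle: the coefficient of
    z^n in (Q / P) P^2 = Q P is G_n.  To stay among polynomials, write
    (1 - z) P = 1 - E, where E has nonnegative coefficients summing to 1
    because c_k decreases; so |E| <= 1 on the closed disk.  Replace 1 / P by
    V = v(E) / P, with a polynomial v such that v(w) = 1 + O(w^(n+1)),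
    v(1) = 0 and |v| <= 1 + e on the disk ([ex_flat_poly]).  Since v(1) = 0,
    1 - E divides v(E) and V is a polynomial; Q V has n-th partial sum exactly
    G_n and modulus |v(E)| <= 1 + e on the circle ([landau_extremal]).  Its
    degree is brought below d by a Fejer mean, which does not increase the
    norm (take g = 1 + z + ... + z^(d-1)) and changes the partial sum by
    (1/d) (a_1 + 2 a_2 + ... + n a_n); by summation by parts and the upper
    bound this is at most 2n/d (1 + e) G_n.  Finally e tends to 0.

    The constant pi enters through Wallis' inequalities
    1 / (pi (k + 1)) <= c_k^2 <= 1 / (pi k), the second one for k >= 1. *)

(** * Averages over roots of unity *)

Lemma exists_prim_root (C : numClosedFieldType) (N : nat) :
  (0 < N)%N -> exists w : C, N.-primitive_root w.
Proof.
pose p : {poly C} := 'X^N - 1; have [s Dp] := closed_field_poly_normal p.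
move=> N_gt0; rewrite (monicP _) ?monicXnsubC// scale1r in Dp.
have sN : all N.-unity_root s by apply/allP => z; rewrite -root_prod_XsubC -Dp.
have sz_s : (N < (size s).+1)%N.
  by rewrite -(size_prod_XsubC s id) -Dp size_XnsubC.
have [|z] := hasP (has_prim_root N_gt0 sN _ sz_s); last by exists z.
by rewrite -separable_prod_XsubC -Dp separable_Xn_sub_1// pnatr_eq0 -lt0n.
Qed.

Section RootAveraging.
Variables (C : numClosedFieldType) (N : nat) (w : C).
Hypothesis w_prim : N.-primitive_root w.

Lemma norm_prim_root_exp j : `|w ^+ j| = 1.
Proof.
rewrite normrX; suff -> : `|w| = 1 by rewrite expr1n.
apply/eqP; rewrite -(@pexpr_eq1 _ _ N) ?normr_ge0 ?(prim_order_gt0 w_prim)//.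
by rewrite -normrX (prim_expr_order w_prim) normr1.
Qed.

Lemma sum_prim_root_coef (p : {poly C}) m : (size p <= N)%N -> (m < N)%N ->
  \sum_(j < N) p.[w ^+ j] / (w ^+ j) ^+ m = N%:R * p`_m.
Proof.
move=> pN mN; have w0 : w != 0.
  by rewrite -normr_eq0 -[w]expr1 norm_prim_root_exp oner_neq0.
under eq_bigr => j _ do rewrite (horner_coef_wide _ pN) mulr_suml.
rewrite exchange_big /= (bigD1 (Ordinal mN)) //=.
rewrite [X in X + _](eq_bigr (fun=> p`_m)) => [|j _]; last first.
  by rewrite mulfK // !expf_neq0.
rewrite sumr_const card_ord mulr_natl big1 ?addr0 // => i im.
under eq_bigr => j _ do rewrite -mulrA !(exprAC w j) -expr_div_n.
rewrite -mulr_sumr; apply/eqP; rewrite mulf_eq0; apply/orP; right.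
(* For i != m this is a sum over the powers of u != 1 with u ^+ N = 1. *)
set u := w ^+ i / w ^+ m.
have u1 : u - 1 != 0.
  rewrite subr_eq0; apply: contra im => /eqP E.
  have /eqP : w ^+ i = w ^+ m by rewrite -[RHS]mul1r -E /u divfK ?expf_neq0.
  by rewrite (eq_prim_root_expr w_prim) !modn_small.
rewrite -(mulrI_eq0 _ (mulfI u1)) -subrX1 expr_div_n !(exprAC w _ N).
by rewrite (prim_expr_order w_prim) !expr1n divr1 subrr.
Qed.

Lemma sum_prim_root_norm (g : {poly C}) : (size g <= N)%N ->
  \sum_(j < N) `|g.[w ^+ j]| ^+ 2 = N%:R * \sum_(k < N) `|g`_k| ^+ 2.
Proof.
move=> gN.
rewrite mulr_sumr; under [RHS]eq_bigr => k _.
  rewrite normCK mulrA -(sum_prim_root_coef gN (ltn_ord k)) mulr_suml.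
  over.
rewrite exchange_big /=; apply: eq_bigr => j _.
rewrite normCK [X in X^*](horner_coef_wide _ gN) rmorph_sum mulr_sumr.
apply: eq_bigr => k _; rewrite rmorphM rmorphXn/= -exprVn.
rewrite (invC_norm (w ^+ j)) norm_prim_root_exp expr1n invr1 mul1r.
by rewrite mulrA mulrAC.
Qed.
End RootAveraging.

(** On the circle |f g^2| <= M |g|^2, so the trivial bound on the average that
    computes a coefficient of f g^2 involves only the mean square of g.  This
    is the source of every estimate on polynomials below, for g = 1,
    g = 1 + ... + z^(d-1) and g a Taylor polynomial of (1 - z)^(-1/2). *)
Lemma norm_coef_mul_sqr (C : numClosedFieldType) (f g : {poly C}) (M : C)
    (l m : nat) :
  (forall z, `|z| = 1 -> `|f.[z]| <= M) -> (size g <= l)%N ->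
  `|(f * g ^+ 2)`_m| <= M * \sum_(k < l) `|g`_k| ^+ 2.
Proof.
(* N exceeds m and the sizes of f g^2 and g, so that nothing wraps around. *)
move=> fM gl; pose N := (size (f * g ^+ 2)%R + l + m.+1)%N.
have N_gt0 : (0 < N)%N by rewrite /N addnS.
have [w wP] := exists_prim_root C N_gt0.
have N0 : (0 : C) < N%:R by rewrite ltr0n.
rewrite -(ler_pM2l N0) -[X in X * `|_|](gtr0_norm N0) -normrM.
rewrite -(sum_prim_root_coef wP); last 2 first.
- by rewrite /N -addnA leq_addr.
- by rewrite /N leq_addl.
apply: le_trans (ler_norm_sum _ _ _) _.
have -> : N%:R * (M * \sum_(k < l) `|g`_k| ^+ 2) =
    M * \sum_(j < N) `|g.[w ^+ j]| ^+ 2.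
  have lN : (l <= N)%N by rewrite /N addnAC leq_addl.
  rewrite (sum_prim_root_norm wP (leq_trans gl lN)).
  rewrite mulrCA; congr (_ * (_ * _)).
  rewrite (big_ord_widen N (fun k => `|g`_k| ^+ 2) lN) big_mkcond/=.
  apply: eq_bigr => k _; case: ltnP => // lk.
  by rewrite nth_default ?normr0 ?expr0n// (leq_trans gl).
rewrite mulr_sumr; apply: ler_sum => j _.
rewrite hornerM horner_exp !normrM normfV -exprM (norm_prim_root_exp wP).
rewrite invr1 mulr1 -expr2 ler_wpM2r ?exprn_ge0//.
by apply: fM; rewrite (norm_prim_root_exp wP).
Qed.

(** Cauchy's estimate. *)
Lemma norm_coef_le (C : numClosedFieldType) (f : {poly C}) (M : C) m :
  (forall z, `|z| = 1 -> `|f.[z]| <= M) -> `|f`_m| <= M.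
Proof.
move=> fM; have := @norm_coef_mul_sqr C f 1 M 1 m fM.
by rewrite size_poly1 expr1n mulr1 big_ord1 coef1 normr1 expr1n mulr1; apply.
Qed.

(** * Fejer means *)

Definition fejer_mean (F : fieldType) (d : nat) (f : {poly F}) : {poly F} :=
  \poly_(k < d) ((1 - k%:R / d%:R) * f`_k).

(** With D = 1 + x + ... + x^(d-1), the coefficient of x^(d-1) in f(z x) D(x)^2
    is d times the value at z of the Fejer mean of f, and the squares of the
    coefficients of D add up to d: the positivity of the Fejer kernel |D|^2 / d
    is hidden in [norm_coef_mul_sqr]. *)
Lemma norm_fejer_mean (C : numClosedFieldType) (f : {poly C}) (M : C) d :
  (0 < d)%N -> (forall z, `|z| = 1 -> `|f.[z]| <= M) ->
  forall z, `|z| = 1 -> `|(fejer_mean d f).[z]| <= M.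
Proof.
move=> d_gt0 fM z z1.
have d0 : (0 : C) < d%:R by rewrite ltr0n.
pose fz := \poly_(k < size f) (f`_k * z ^+ k).
pose D : {poly C} := \poly_(k < d) 1.
have fzM x : `|x| = 1 -> `|fz.[x]| <= M.
  move=> x1; suff -> : fz.[x] = f.[z * x].
    by apply: fM; rewrite normrM z1 x1 mulr1.
  rewrite horner_poly horner_coef; apply: eq_bigr => k _.
  by rewrite exprMn mulrA.
have D2 i : (i < d)%N -> (D ^+ 2)`_i = i.+1%:R.
  move=> id; rewrite expr2 coefM (eq_bigr (fun=> 1)) => [|j _].
    by rewrite sumr_const card_ord.
  rewrite !coef_poly (leq_ltn_trans (leq_ord j) id).
  by rewrite (leq_ltn_trans (leq_subr _ _) id) mulr1.
have E : (fz * D ^+ 2)`_d.-1 = d%:R * (fejer_mean d f).[z].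
  rewrite coefM prednK// horner_poly mulr_sumr; apply: eq_bigr => k _.
  rewrite D2; last by rewrite (leq_ltn_trans (leq_subr _ _)) ?ltn_predL.
  rewrite coef_poly; case: ltnP => [_|kf]; last first.
    by rewrite nth_default// !(mulr0, mul0r).
  rewrite -subSn ?prednK//; last by rewrite -ltnS prednK.
  rewrite natrB ?(ltnW (ltn_ord _))//.
  by field; rewrite gt_eqF.
rewrite -(ler_pM2l d0) -[X in X * `|_|](gtr0_norm d0) -normrM -E.
rewrite [leRHS]mulrC; apply: le_trans (norm_coef_mul_sqr _ fzM (size_poly _ _)) _.
rewrite (eq_bigr (fun=> 1)) => [|k _]; first by rewrite sumr_const card_ord.
by rewrite coef_poly ltn_ord normr1 expr1n.
Qed.

(** * Landau's constant and the upper bound *)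

(** These are the Taylor coefficients of (1 - z)^(-1/2), that is,
    binom(2k, k) / 4^k. *)
Definition isqrt_coef (F : fieldType) (k : nat) : F :=
  \prod_(j < k) (j.*2.+1%:R / j.*2.+2%:R).

Definition landau_const (F : fieldType) (n : nat) : F :=
  \sum_(k < n.+1) isqrt_coef F k ^+ 2.

Section IsqrtCoef.
Variable F : numFieldType.
Local Notation c := (isqrt_coef F).

Lemma isqrt_coef0 : c 0 = 1.
Proof. exact: big_ord0. Qed.

Lemma isqrt_coef_gt0 k : 0 < c k.
Proof. by apply: prodr_gt0 => j _; rewrite divr_gt0// ltr0n. Qed.

Lemma isqrt_coef_rec k : k.*2.+2%:R * c k.+1 = k.*2.+1%:R * c k :> F.
Proof.
by rewrite /c big_ord_recr/= mulrC -mulrA divfK ?pnatr_eq0// mulrC.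
Qed.

Lemma isqrt_coefS k : k.+1%:R * c k.+1 = (k%:R + 2^-1) * c k :> F.
Proof.
have c2 : (2 : F) != 0 by rewrite pnatr_eq0.
suff E : 2 * (k.+1%:R * c k.+1) = 2 * ((k%:R + 2^-1) * c k).
  exact: (mulfI c2).
rewrite mulrA -natrM mul2n doubleS isqrt_coef_rec.
by rewrite -natr1 -mul2n natrM; field.
Qed.

Lemma isqrt_coefS_le k : c k.+1 <= c k.
Proof.
have k0 : 0 < k.*2.+2%:R :> F by rewrite ltr0n.
rewrite -(ler_pM2l k0) isqrt_coef_rec.
by rewrite ler_wpM2r ?ler_nat// ltW// isqrt_coef_gt0.
Qed.

(** The square of (1 - z)^(-1/2) is 1 + z + z^2 + ....  With s m the left-hand
    side, symmetry in j and m - j turns (m + 1) s (m + 1) into twice the sum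
    weighted by j; there the recurrence for c, symmetry again and the induction
    hypothesis give m s m + s m, whence s (m + 1) = s m. *)
Lemma sum_isqrt_coef m : \sum_(j < m.+1) c j * c (m - j) = 1.
Proof.
elim: m => [|m IH]; first by rewrite big_ord1 isqrt_coef0 mulr1.
pose s a := \sum_(j < a.+1) c j * c (a - j).
have sym a : a%:R * s a = 2 * \sum_(j < a.+1) j%:R * (c j * c (a - j)).
  pose t := \sum_(j < a.+1) (a - j)%:R * (c j * c (a - j)).
  have -> : a%:R * s a = \sum_(j < a.+1) j%:R * (c j * c (a - j)) + t.
    rewrite mulr_sumr -big_split; apply: eq_bigr => j _ /=.
    by rewrite -mulrDl -natrD subnKC// -ltnS.
  rewrite /t (reindex_inj rev_ord_inj)/= mulr2n mulrDl mul1r; congr (_ + _).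
  apply: eq_bigr => j _; rewrite subSS subKn ?leq_ord//.
  by rewrite [c j * _]mulrC.
have m1 : (m.+1%:R : F) != 0 by rewrite pnatr_eq0.
apply: (mulfI m1); rewrite -[LHS]/(m.+1%:R * s m.+1) sym big_ord_recl mul0r add0r.
rewrite (eq_bigr (fun j : 'I_m.+1 => j%:R * (c j * c (m - j)) +
    2^-1 * (c j * c (m - j)))) => [|j _].
  by rewrite big_split/= mulrDr -sym -mulr_sumr /s IH; field.
rewrite lift0 subSS mulrA isqrt_coefS; ring.
Qed.

Lemma landau_const_homo : {homo landau_const F : m n / (m <= n)%N >-> m <= n}.
Proof.
apply: homo_leq => [//||m]; first exact: le_trans.
rewrite /landau_const [leRHS]big_ord_recr/= lerDl exprn_ge0// ltW//.
exact: isqrt_coef_gt0.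
Qed.

End IsqrtCoef.

Section Landau.
Variables (C : numClosedFieldType) (n : nat).
Local Notation c := (isqrt_coef C).
Local Notation P := (\poly_(k < n.+1) c k).

Lemma norm_isqrt_coef k : `|c k| = c k.
Proof. by rewrite gtr0_norm ?isqrt_coef_gt0. Qed.

(** P ^+ 2 agrees with 1 + z + z^2 + ... up to degree n, and multiplying by this
    series sums coefficients. *)
Lemma partial_sum_coef_mul (f : {poly C}) :
  \sum_(k < n.+1) f`_k = (f * P ^+ 2)`_n.
Proof.
rewrite coefM; apply: eq_bigr => k _.
suff -> : (P ^+ 2)`_(n - k) = 1 by rewrite mulr1.
rewrite expr2 coefM -(sum_isqrt_coef C (n - k)); apply: eq_bigr => j _.
have mn : (n - k < n.+1)%N by rewrite ltnS leq_subr.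
by rewrite !coef_poly !(leq_ltn_trans _ mn) ?leq_subr ?leq_ord.
Qed.

(** Landau's inequality: apply [norm_coef_mul_sqr] with g = P. *)
Lemma landau_upper (f : {poly C}) (M : C) :
  (forall z, `|z| = 1 -> `|f.[z]| <= M) ->
  `|\sum_(k < n.+1) f`_k| <= M * landau_const C n.
Proof.
move=> fM; rewrite partial_sum_coef_mul.
apply: le_trans (norm_coef_mul_sqr _ fM (size_poly _ _)) _.
rewrite le_eqVlt; apply/orP; left; apply/eqP; congr (_ * _).
by apply: eq_bigr => k _; rewrite coef_poly ltn_ord norm_isqrt_coef.
Qed.

(** Since (1 - z) P = 1 - E, a polynomial in E that vanishes at E = 1 is a
    multiple of P; this is how P gets inverted approximately.  The coefficients
    of E are 0, then the differences c (k - 1) - c k, and c n at the end, where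
    P stops. *)
Let E : {poly C} := 1 - (1 - 'X) * P.

Let coefE k : E`_k = if k is k'.+1 then P`_k' - P`_k'.+1 else 0.
Proof.
rewrite /E mulrBl mul1r !coefB coef1 coefXM.
by case: k => [|k] /=; rewrite ?coef_poly/= ?isqrt_coef0; ring.
Qed.

Let coefE_ge0 k : 0 <= E`_k.
Proof.
rewrite coefE; case: k => // k; rewrite !coef_poly !ltnS.
case: (ltngtP k n) => // kn; rewrite ?subr0 ?subrr//.
  by rewrite subr_ge0 isqrt_coefS_le.
by rewrite ltW ?isqrt_coef_gt0.
Qed.

Let norm_hornerE z : `|z| <= 1 -> `|E.[z]| <= 1.
Proof.
move=> z1; have <- : E.[1] = 1 by rewrite !hornerE subrr mul0r subr0.
rewrite !horner_coef; apply: le_trans (ler_norm_sum _ _ _) _.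
apply: ler_sum => k _; rewrite normrM normrX expr1n ger0_norm// ler_wpM2l//.
by rewrite exprn_ile1.
Qed.

(** * Polynomials that nearly attain Landau's bound *)

(** The polynomial is Q V, with Q the reversal of P and P V = v(E).  On the
    circle |Q V| = |P V| = |v(E)| <= M.  Its n-th partial sum is the
    coefficient of z^n in Q V P^2 = Q P v(E), and v(E) = 1 up to terms of
    degree > n since v = 1 + 'X^(n+1) u and 'X divides E; in Q P that
    coefficient is the sum of the c k ^+ 2. *)
Lemma landau_extremal (v u : {poly C}) (M : C) :
  v = 1 + 'X^(n.+1) * u -> v.[1] = 0 ->
  (forall w, `|w| <= 1 -> `|v.[w]| <= M) ->
  exists f : {poly C}, (forall z, `|z| = 1 -> `|f.[z]| <= M) /\
    \sum_(k < n.+1) f`_k = landau_const C n.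
Proof.
move=> vE /eqP/factor_theorem[q vq] vM.
pose V := ('X - 1) * (q \Po E).
have PV : P * V = v \Po E.
  rewrite vq comp_polyM comp_polyB comp_polyX comp_polyC /V mulrCA mulrA.
  by rewrite [RHS]mulrC polyC1 /E; ring.
have [E' EX] : exists E', E = 'X * E'.
  have : root E 0 by rewrite /root horner_coef0 coefE.
  by move=> /factor_theorem[E']; rewrite subr0 mulrC => ?; exists E'.
pose Q := \poly_(k < n.+1) c (n - k).
exists (Q * V); split=> [z z1|].
  have QP : `|Q.[z]| = `|P.[z]|.
    (* On the circle, Q(z) = z^n times the conjugate of P(z). *)
    rewrite -[RHS]norm_conjC -[RHS]mul1r -[X in X * _](expr1n C n) -z1 -normrX.
    rewrite -normrM !horner_poly; congr `|_|.
    rewrite rmorph_sum mulr_sumr (reindex_inj rev_ord_inj)/=.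
    apply: eq_bigr => k _; rewrite subSS subKn ?leq_ord// rmorphM rmorphXn/=.
    rewrite -[in (c k)^*]norm_isqrt_coef.
    rewrite (conj_Creal (normr_real _)) norm_isqrt_coef.
    rewrite -[in X in _ = X * _](subnK (leq_ord k)) exprD mulrCA -mulrA -exprMn.
    by rewrite -normCK z1 !expr1n mulr1.
  rewrite hornerM normrM QP -normrM -hornerM PV horner_comp; apply: vM.
  by apply: norm_hornerE; rewrite z1.
rewrite partial_sum_coef_mul.
have -> : Q * V * P ^+ 2 = Q * P + 'X^(n.+1) * (E' ^+ n.+1 * (u \Po E) * Q * P).
  have -> : Q * V * P ^+ 2 = Q * P * (v \Po E) by rewrite -PV; ring.
  rewrite vE comp_polyD comp_polyM comp_Xn_poly comp_polyC.
  by rewrite [X in X ^+ n.+1]EX exprMn; ring.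
rewrite coefD coefXnM ltnSn addr0 coefM.
rewrite /landau_const [RHS](reindex_inj rev_ord_inj); apply: eq_bigr => k _ /=.
by rewrite !coef_poly ltn_ord ltnS leq_subr subSS expr2.
Qed.
End Landau.

(** The function (1 - w) / (1 - r w) is 1 at 0, vanishes at 1, and is at most
    2 / (1 + r) on the disk: (1 + r) (1 - w) = (1 - r w) + (r - w), where
    |r - w| <= |1 - r w| by the Schwarz-Pick inequality.  Truncating the
    geometric series costs the factor 1 + r^(l+1), and replacing w by w^(n+1)
    makes the result flat to order n at 0. *)
Lemma ex_flat_poly (C : numClosedFieldType) (n l : nat) (r : C) :
  0 <= r -> r < 1 -> exists v u : {poly C},
    [/\ v = 1 + 'X^(n.+1) * u, v.[1] = 0 &
      forall w, `|w| <= 1 -> `|v.[w]| <= 2 / (1 + r) * (1 + r ^+ l.+1)].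
Proof.
move=> r0 r1.
pose v1 : {poly C} := (1 - 'X) * \sum_(j < l.+1) (r%:P * 'X) ^+ j.
have [u1 u1E] : exists u1, v1 - 1 = u1 * ('X - 0%:P).
  apply/factor_theorem; rewrite /root !hornerE horner_sum.
  rewrite big_ord_recl big1 => [|i _].
    by rewrite !hornerE; apply/eqP; ring.
  by rewrite horner_exp !hornerE expr0n.
exists (v1 \Po 'X^(n.+1)), (u1 \Po 'X^(n.+1)); split.
- have -> : v1 = 1 + 'X * u1.
    by apply/eqP; rewrite addrC -subr_eq u1E subr0 mulrC.
  by rewrite comp_polyD comp_polyM comp_polyX comp_polyC.
- by rewrite horner_comp hornerXn expr1n !hornerE subrr mul0r.
move=> w0 w01; rewrite horner_comp hornerXn.
have : `|w0 ^+ n.+1| <= 1 by rewrite normrX exprn_ile1.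
move: (w0 ^+ n.+1) => w w1 {w0 w01}.
have rp : 0 < 1 + r by rewrite ltr_pwDl.
have rw1 : `|r * w| <= r by rewrite normrM (ger0_norm r0) ler_piMr.
have d0 : 0 < `|1 - r * w|.
  rewrite normr_gt0 subr_eq0; apply: contraTneq r1 => h.
  move: rw1; rewrite -h normr1 => h1.
  by apply/negP => /(le_lt_trans h1); rewrite ltxx.
have vw : `|v1.[w]| * `|1 - r * w| = `|1 - w| * `|1 - (r * w) ^+ l.+1|.
  rewrite -!normrM; congr `|_|.
  rewrite !hornerE horner_sum -mulrA; congr (_ * _).
  under eq_bigr => j _ do rewrite horner_exp !hornerE.
  by rewrite mulrC -[RHS]opprB subrX1 -[RHS]mulNr opprB.
rewrite -(ler_pM2r d0) vw mulrAC; apply: ler_pM => //; last first.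
  apply: le_trans (ler_normB _ _) _; rewrite normr1 lerD2l normrX.
  by rewrite lerXn2r ?nnegrE.
rewrite mulrAC ler_pdivlMr// -[X in _ * X]ger0_norm ?(ltW rp)// -normrM.
have -> : (1 - w) * (1 + r) = (1 - r * w) + (r - w) by ring.
apply: le_trans (ler_normD _ _) _; rewrite mulr2n mulrDl mul1r lerD2l.
(* |1 - r w|^2 - |r - w|^2 = (1 - r^2) (1 - |w|^2) *)
rewrite -(@ler_pXn2r _ 2) ?nnegrE// !normCK.
rewrite !rmorphB !rmorphM rmorph1 /= (conj_Creal (ger0_real r0)) -subr_ge0.
have -> : (1 - r * w) * (1 - r * w^*) - (r - w) * (r - w^* ) =
   (1 - r ^+ 2) * (1 - w * w^*) by ring.
by rewrite -normCK mulr_ge0// subr_ge0 ?exprn_ile1// ltW.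
Qed.

(** The triangle inequality would lose a factor n / log n here.  Summation by
    parts expresses the sum through the partial sums S_j of the coefficients,
    as n S_n - (S_0 + ... + S_(n-1)), and each S_j obeys Landau's bound. *)
Lemma norm_sum_coef_natr (C : numClosedFieldType) (n : nat) (f : {poly C})
    (M : C) :
  (forall z, `|z| = 1 -> `|f.[z]| <= M) ->
  `|\sum_(k < n.+1) k%:R * f`_k| <= 2 * n%:R * (M * landau_const C n).
Proof.
move=> fM.
have M0 : 0 <= M by apply: le_trans (fM 1 (normr1 _)).
have -> : \sum_(k < n.+1) k%:R * f`_k =
    n%:R * \sum_(k < n.+1) f`_k - \sum_(j < n) \sum_(k < j.+1) f`_k.
  elim: n => [|n IH]; first by rewrite !big_ord1 big_ord0 !mul0r subrr.
  rewrite big_ord_recr/= IH [in RHS]big_ord_recr/=.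
  by rewrite [X in _ = _ - X]big_ord_recr/= -natr1; ring.
apply: le_trans (ler_normB _ _) _.
rewrite mulrDl mul1r mulrDl lerD//.
  by rewrite normrM normr_nat ler_wpM2l// landau_upper.
apply: le_trans (ler_norm_sum _ _ _) _.
rewrite [leRHS](_ : _ = \sum_(j < n) (M * landau_const C n)); last first.
  by rewrite sumr_const card_ord mulr_natl.
apply: ler_sum => j _.
apply: le_trans (landau_upper _ fM) _; rewrite ler_wpM2l//.
by apply: landau_const_homo; apply: ltnW.
Qed.

Lemma partial_sum_fejer (C : numClosedFieldType) (n d : nat) (f : {poly C})
    (M : C) :
  (n < d)%N ->
  (forall z, `|z| = 1 -> `|f.[z]| <= M) ->
  `|\sum_(k < n.+1) (fejer_mean d f)`_k - \sum_(k < n.+1) f`_k| <=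
    2 * n%:R / d%:R * (M * landau_const C n).
Proof.
move=> nd fM.
have -> : \sum_(k < n.+1) (fejer_mean d f)`_k - \sum_(k < n.+1) f`_k =
    - (\sum_(k < n.+1) k%:R * f`_k) / d%:R.
  rewrite -sumrB -sumrN mulr_suml; apply: eq_bigr => k _.
  by rewrite coef_poly (leq_trans (ltn_ord k) nd); ring.
rewrite mulNr normrN normrM normfV normr_nat mulrAC ler_wpM2r ?invr_ge0//.
exact: norm_sum_coef_natr.
Qed.

Lemma rmorph_isqrt_coef (F K : fieldType) (h : {rmorphism F -> K}) k :
  h (isqrt_coef F k) = isqrt_coef K k.
Proof.
by rewrite rmorph_prod; apply: eq_bigr => j _; rewrite fmorph_div !rmorph_nat.
Qed.

Lemma rmorph_landau_const (F K : fieldType) (h : {rmorphism F -> K}) n :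
  h (landau_const F n) = landau_const K n.
Proof.
rewrite rmorph_sum; apply: eq_bigr => k _.
by rewrite rmorphXn/= rmorph_isqrt_coef.
Qed.

(** * From the circle to the disk and back *)

Section RealLimits.
Variable R : realType.
Implicit Types x y B : R.

Lemma le_of_le_affine x y B :
  (forall t, 0 < t -> t < 1 -> x <= y + B * t) -> x <= y.
Proof.
move=> h; rewrite leNgt; apply/negP => yx.
pose D := x - y + `|B| + 1.
have D0 : 0 < D by rewrite /D; have := normr_ge0 B; lra.
have t0 : 0 < (x - y) / D by rewrite divr_gt0// subr_gt0.
have t1 : (x - y) / D < 1.
  by rewrite ltr_pdivrMr// /D; have := normr_ge0 B; lra.
have := h _ t0 t1; apply/negP; rewrite -ltNge -ltrBrDl.
rewrite mulrA ltr_pdivrMr// mulrC ltr_pM2l ?subr_gt0//.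
by rewrite /D; have := ler_norm B; lra.
Qed.

(** Bernoulli's inequality: otherwise (x / y) ^+ m would exceed B. *)
Lemma le_of_le_exprn x y B : 0 <= x -> 0 <= y ->
  (forall m, x ^+ m <= B * y ^+ m) -> x <= y.
Proof.
move=> x0 y0 h; rewrite leNgt; apply/negP => yx.
have [y00|yp] := eqVneq y 0.
  by have := h 1%N; rewrite !expr1 y00 mulr0; lra.
have {}yp : 0 < y by rewrite lt_neqAle eq_sym yp.
pose e := x / y - 1.
have e0 : 0 < e by rewrite subr_gt0 ltr_pdivlMr// mul1r.
have xyE : x / y = 1 + e by rewrite /e; ring.
have bern m : 1 + m%:R * e <= (x / y) ^+ m.
  rewrite xyE; elim: m => [|m IH]; first by rewrite mul0r addr0.
  rewrite exprS; apply: le_trans (ler_wpM2l _ IH); last by lra.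
  rewrite -natr1; have : 0 <= m%:R * e * e :> R by rewrite !mulr_ge0 ?(ltW e0).
  by lra.
have := bern (Num.bound (B / e)).
have : B / e < (Num.bound (B / e))%:R.
  exact: unstable.ltr_bound.
set m := Num.bound _ => Bm.
have := h m; rewrite expr_div_n -ler_pdivrMr ?exprn_gt0//.
move: Bm; rewrite ltr_pdivrMr//; lra.
Qed.
End RealLimits.

Section DiskBounds.
Variable R : realType.
Implicit Types (f : {poly R[i]}) (z : R[i]) (M : R).
Local Notation "x %:C" := (real_complex _ x).

(** Cauchy's estimate for f ^+ m gives |f(z)|^m <= M^m / (1 - |z|) for all m,
    and m-th roots make the factor 1 / (1 - |z|) disappear. *)
Lemma max_modulus f M :
  (forall z, `|z| = 1 -> `|f.[z]| <= M%:C) ->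
  forall z, `|z| < 1 -> `|f.[z]| <= M%:C.
Proof.
move=> fM z z1.
have MC0 : 0 <= M%:C by apply: le_trans (fM 1 (normr1 _)).
have M0 : 0 <= M by rewrite -lecR.
pose x := normc z; have zx : `|z| = x%:C := normr_normc z.
have x1 : x < 1 by rewrite -ltcR -zx.
have x0 : 0 <= x by rewrite -lecR -zx normr_ge0.
pose y := normc f.[z]; have fy : `|f.[z]| = y%:C := normr_normc _.
rewrite fy lecR; apply: (@le_of_le_exprn _ _ _ (1 - x)^-1) => // [|m].
  by rewrite -lecR -fy normr_ge0.
rewrite mulrC ler_pdivlMr ?subr_gt0//.
rewrite -lecR rmorphM rmorphXn rmorphB rmorph1 rmorphXn/= -fy -zx.
rewrite -normrX -horner_exp.
have coefM k : `|(f ^+ m)`_k| <= M%:C ^+ m.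
  apply: norm_coef_le => w w1; rewrite horner_exp normrX.
  by rewrite lerXn2r ?nnegrE// fM.
have d0 : 0 < 1 - `|z| by rewrite subr_gt0.
have : `|(f ^+ m).[z]| <= M%:C ^+ m * \sum_(k < size (f ^+ m)) `|z| ^+ k.
  rewrite horner_coef mulr_sumr; apply: le_trans (ler_norm_sum _ _ _) _.
  by apply: ler_sum => k _; rewrite normrM normrX ler_wpM2r// exprn_ge0.
rewrite -(ler_pM2r d0) => /le_trans; apply.
rewrite -mulrA ler_piMr ?exprn_ge0// mulrC.
rewrite -[leLHS]opprK -mulNr opprB -subrX1 opprB.
by rewrite lerBlDr lerDl exprn_ge0.
Qed.

(** If f - f(z) = q ('X - z), then f(z) and f((1 - t) z) differ by at most
    t times the sum of the |q_k|. *)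
Lemma bound_on_circle f M :
  (forall z, `|z| < 1 -> `|f.[z]| <= M%:C) ->
  forall z, `|z| = 1 -> `|f.[z]| <= M%:C.
Proof.
move=> fM z z1.
have [q qE] : exists q, f - f.[z]%:P = q * ('X - z%:P).
  by apply/factor_theorem; rewrite /root !hornerE subrr.
pose B := \sum_(k < size q) normc q`_k.
pose y := normc f.[z]; have fy : `|f.[z]| = y%:C := normr_normc _.
rewrite fy lecR; apply: (@le_of_le_affine _ _ _ B) => t t0 t1.
rewrite -lecR rmorphD rmorphM/= -fy.
pose s := (1 - t)%:C.
have s0 : 0 <= s by rewrite ler0c subr_ge0 ltW.
have s1 : s < 1 by rewrite -(rmorph1 (real_complex R)) ltcR ltrBlDr ltrDl.
have sz : `|s * z| < 1 by rewrite normrM z1 mulr1 ger0_norm.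
have := congr1 (fun p => p.[s * z]) qE.
rewrite !hornerE => /(canRL (subrK _)) E.
have -> : f.[z] = f.[s * z] - q.[s * z] * (s * z - z) by rewrite E; ring.
apply: le_trans (ler_normB _ _) _; rewrite lerD ?fM//.
rewrite normrM; have -> : s * z - z = - (t%:C * z).
  by rewrite /s rmorphB rmorph1/=; ring.
rewrite normrN normrM z1 mulr1 [`|t%:C|]ger0_norm ?ler0c ?(ltW t0)//.
rewrite ler_wpM2r ?ler0c ?(ltW t0)// horner_coef rmorph_sum.
apply: le_trans (ler_norm_sum _ _ _) _; apply: ler_sum => k _.
rewrite normrM normrX /= -normr_normc ler_piMr ?normr_ge0// exprn_ile1//.
exact: ltW.
Qed.

(** * Bounds on the maximal partial sum *)

Lemma near_extremal n (e : R) : 0 < e -> e < 1 ->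
  exists f, (forall z, `|z| = 1 -> `|f.[z]| <= (1 + e)%:C) /\
    \sum_(k < n.+1) f`_k = (landau_const R n)%:C.
Proof.
(* For r = 1 - e/3 and r^(l+1) <= e/3, the norm bound of [ex_flat_poly] is at
   most (1 + e/3)^2 <= 1 + e. *)
move=> e0 e1; have [r rE] : exists r, r = 1 - e / 3 by exists (1 - e / 3).
have r0 : 0 < r by lra.
have r1 : r < 1 by lra.
have [l rl] : exists l, r ^+ l.+1 <= e / 3.
  apply: contrapT => /forallNP h; suff : 1 <= r by lra.
  apply: (@le_of_le_exprn _ _ _ (3 / e)) => // [|m]; first exact: ltW.
  rewrite expr1n -ler_pdivrMl ?divr_gt0// invf_div mulr1.
  case: m => [|m]; first by rewrite expr0; lra.
  by rewrite leNgt; apply/negP => /ltW /h.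
have r0C : 0 <= r%:C by rewrite ler0c ltW.
have r1C : r%:C < 1 by rewrite -(rmorph1 (real_complex R)) ltcR.
have [v [u [vE v1 vM]]] := ex_flat_poly n l r0C r1C.
rewrite [(landau_const R n)%:C](rmorph_landau_const (real_complex R)).
apply: (landau_extremal vE v1) => w /vM /le_trans; apply.
rewrite -[X in _ <= X]/((1 + e)%:C).
have -> : 2 / (1 + r%:C) * (1 + r%:C ^+ l.+1) =
    (2 / (1 + r) * (1 + r ^+ l.+1))%:C.
  by rewrite !rmorphM fmorphV rmorph_nat !rmorphD !rmorph1 rmorphXn.
rewrite lecR mulrAC ler_pdivrMr; last by lra.
nra.
Qed.

Lemma fejer_near_extremal n d (e : R) : (n < d)%N -> 0 < e -> e < 1 ->
  landau_const R n * (1 - 2 * n%:R / d%:R * (1 + e))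
    <= (1 + e) * max_partial_sum R n d.
Proof.
move=> nd e0 e1; have [f [fM fS]] := near_extremal n e0 e1.
have d_gt0 : (0 < d)%N by apply: leq_ltn_trans nd.
have ep : 0 < 1 + e by lra.
pose F := ((1 + e)^-1)%:C *: fejer_mean d f.
have [_ ub] := max_partial_sumP R nd.
set S := \sum_(k < n.+1) (fejer_mean d f)`_k.
have -> : landau_const R n * (1 - 2 * n%:R / d%:R * (1 + e)) =
    landau_const R n - 2 * n%:R / d%:R * ((1 + e) * landau_const R n) by ring.
apply: (@le_trans _ _ (normc S)).
  rewrite lerBlDr -lecR rmorphD/= -!normr_normc -lerBlDl.
  have := partial_sum_fejer nd fM; rewrite fS -/S.
  rewrite -[landau_const R[i] n](rmorph_landau_const (real_complex R)).
  set G : R[i] := (landau_const R n)%:C => h.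
  have <- : `|G| = G.
    rewrite ger0_norm// ler0c sumr_ge0// => k _.
    by rewrite exprn_ge0// ltW// isqrt_coef_gt0.
  apply: le_trans (lerB_dist _ _) _; rewrite distrC; apply: le_trans h _.
  by rewrite !rmorphM fmorphV !rmorph_nat.
rewrite mulrC -ler_pdivrMr//; apply: ub; exists F.
  split; first by apply: leq_trans (size_scale_leq _ _) (size_poly _ _).
  apply/ge_sup_norm => z z1; rewrite -lecR -normr_normc hornerZ normrM.
  have e0' : 0 <= ((1 + e)^-1)%:C by rewrite ler0c invr_ge0 ltW.
  apply: (@le_trans _ _ (((1 + e)^-1)%:C * (1 + e)%:C)); last first.
    by rewrite -rmorphM mulVf ?gt_eqF.
  rewrite ger0_norm// ler_wpM2l//.
  apply: max_modulus; first exact: norm_fejer_mean.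
  by rewrite normr_normc ltcR.
apply: (@complexI R); rewrite -normr_normc rmorphM/= -normr_normc big_mkord.
under eq_bigr => k _ do rewrite coefZ.
rewrite -mulr_sumr normrM ger0_norm ?ler0c ?invr_ge0 ?(ltW ep)//.
by rewrite mulrC.
Qed.

Theorem max_partial_sum_bounds n d : (n < d)%N ->
  landau_const R n * (1 - 2 * n%:R / d%:R) <= max_partial_sum R n d
    <= landau_const R n.
Proof.
move=> nd; apply/andP; split; last first.
  have [[f [_ /ge_sup_norm f1] <-] _] := max_partial_sumP R nd.
  rewrite -lecR -normr_normc big_mkord -[leRHS]mul1r.
  rewrite [(landau_const R n)%:C](rmorph_landau_const (real_complex R)).
  apply: landau_upper; apply: (@bound_on_circle f 1) => z.
  by rewrite !normr_normc -(rmorph1 (real_complex R)) lecR ltcR; apply: f1.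
pose B := max_partial_sum R n d + landau_const R n * (2 * n%:R / d%:R).
apply: (@le_of_le_affine _ _ _ B) => e e0 e1; rewrite /B.
have := fejer_near_extremal nd e0 e1; lra.
Qed.
End DiskBounds.

(** * Wallis' inequalities *)

Section Wallis.
Variable R : realType.
Local Notation c := (isqrt_coef R).

(** The primitive of cos ^+ m that vanishes at 0, through the reduction formula
    for powers of the cosine; its value at pi / 2 is Wallis' integral, so that
    only derivatives are needed. *)
Fixpoint cos_primitive (m : nat) : R -> R :=
  match m with
  | 0 => id
  | 1 => sin
  | (m'.+1 as m1).+1 => fun x =>
      m%:R^-1 * (sin x * cos x ^+ m1 + m1%:R * cos_primitive m' x)
  end.

Lemma is_derive_cos_primitive m (x : R) :
  is_derive x 1 (cos_primitive m) (cos x ^+ m).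
Proof.
elim/ltn_ind: m x => -[_ x|[_ x|m IH x]]; first exact: is_derive_id.
  by rewrite expr1; exact: is_derive_sin.
have Im := IH m (ltnW (ltnSn _)) x.
pose sc := (sin : R -> R) * (cos : R -> R) ^+ m.+1.
have -> : cos_primitive m.+2 = m.+2%:R^-1 \*: (sc + m.+1%:R \*: cos_primitive m).
  by apply/funext => y; rewrite /sc /= !fctE.
apply: is_derive_eq.
have -> : (cos ^+ m.+1) x = cos x ^+ m.+1 by rewrite exprfctE.
rewrite /GRing.scale /= !exprS.
have /(canRL (addKr _)) s2 := cos2Dsin2 x.
have m2 : m.+2%:R != 0 :> R by rewrite pnatr_eq0.
apply: (mulfI m2); rewrite mulVKf//.
have -> : sin x * (m.+1%:R * cos x ^+ m * - sin x) =
    - (m.+1%:R * cos x ^+ m) * sin x ^+ 2 by ring.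
by rewrite s2 -[m.+2%:R]natr1; ring.
Qed.

Lemma cos_primitive0 m : cos_primitive m 0 = 0.
Proof.
elim/ltn_ind: m => -[|[|m]] IH //=; first exact: sin0.
by rewrite sin0 mul0r IH// !mulr0 addr0 mulr0.
Qed.

Definition wallis m : R := cos_primitive m (pi / 2).

(** The integrand cos ^+ m decreases with m on [0, pi/2]; in terms of
    primitives, this is the mean value theorem for their difference. *)
Lemma wallis_nincr m : wallis m.+1 <= wallis m.
Proof.
pose D (x : R) := cos_primitive m x - cos_primitive m.+1 x.
have dD (x : R) : is_derive x 1 D (cos x ^+ m - cos x ^+ m.+1).
  by apply: is_deriveB; exact: is_derive_cos_primitive.
have h0 : 0 <= pi / 2 :> R by rewrite divr_ge0 ?pi_ge0.
have [|t t01] := @MVT_segment R D _ _ _ h0 (fun x _ => dD x).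
  apply: derivable_within_continuous => x _; exact: ex_derive.
rewrite /D !cos_primitive0 !subr0 -subr_ge0 /wallis => ->.
have ct : 0 <= cos t.
  apply: cos_ge0_pihalf; move: t01; rewrite in_itv/= => /andP[t0 ->].
  by rewrite andbT (le_trans _ t0)// oppr_le0.
rewrite mulr_ge0// exprSr -{1}[cos t ^+ m]mulr1 -mulrBr.
by rewrite mulr_ge0 ?exprn_ge0 ?subr_ge0 ?cos_le1.
Qed.

Lemma wallisSS m : m.+2%:R * wallis m.+2 = m.+1%:R * wallis m.
Proof.
by rewrite /wallis /= cos_pihalf expr0n/= mulr0 add0r mulVKf ?pnatr_eq0.
Qed.

Lemma wallis_even k : wallis k.*2 = isqrt_coef R k * (pi / 2).
Proof.
elim: k => [|k IH]; first by rewrite isqrt_coef0 mul1r.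
have k2 : k.*2.+2%:R != 0 :> R by rewrite pnatr_eq0.
suff : k.*2.+2%:R * wallis k.+1.*2 = k.*2.+2%:R * (c k.+1 * (pi / 2)).
  by move/(mulfI k2).
by rewrite doubleS wallisSS IH !mulrA isqrt_coef_rec.
Qed.

Lemma wallis_odd k : k.*2.+1%:R * isqrt_coef R k * wallis k.*2.+1 = 1.
Proof.
elim: k => [|k IH]; first by rewrite /wallis/= sin_pihalf isqrt_coef0 !mulr1.
by rewrite doubleS mulrAC wallisSS mulrAC isqrt_coef_rec IH.
Qed.

(** [wallis_even] and [wallis_odd] express consecutive Wallis integrals through
    c k and its inverse, so their monotonicity encloses c k ^+ 2. *)
Lemma isqrt_coef_sqr_ge k : 1 / (pi * k.+1%:R) <= c k ^+ 2.
Proof.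
have c0 := isqrt_coef_gt0 R k; have p0 := pi_gt0 R.
have k0 : 0 < k.*2.+1%:R :> R by rewrite ltr0n.
have := wallis_nincr k.*2; rewrite wallis_even.
rewrite -(ler_pM2l (mulr_gt0 k0 c0)) wallis_odd.
rewrite ler_pdivrMr ?mulr_gt0 ?ltr0n// => h; apply: le_trans h _.
have -> : k.*2.+1%:R = 2 * k%:R + 1 :> R by rewrite -natrM natr1 mul2n.
rewrite -natr1 -subr_ge0 [leRHS](_ : _ = c k ^+ 2 * pi / 2); last by field.
by rewrite !mulr_ge0 ?exprn_ge0 ?invr_ge0// ltW.
Qed.

Lemma isqrt_coef_sqr_le k : c k.+1 ^+ 2 <= 1 / (pi * k.+1%:R).
Proof.
have c0 := isqrt_coef_gt0 R k; have p0 := pi_gt0 R.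
have k0 : 0 < k.*2.+1%:R :> R by rewrite ltr0n.
have := wallis_nincr k.*2.+1; rewrite -doubleS wallis_even.
rewrite -(ler_pM2l (mulr_gt0 k0 c0)) wallis_odd.
have -> : k.*2.+1%:R * c k = 2 * k.+1%:R * c k.+1.
  by rewrite -natrM mul2n doubleS isqrt_coef_rec.
rewrite ler_pdivlMr ?mulr_gt0 ?ltr0n// => h; apply: le_trans h.
by rewrite le_eqVlt; apply/orP; left; apply/eqP; field.
Qed.

(** * Logarithmic growth of Landau's constant *)

Lemma ln_le_subr1 (x : R) : 0 < x -> ln x <= x - 1.
Proof. by move=> x0; rewrite -{1}(subrKC 1 x) le_ln1Dx//; lra. Qed.

Lemma ln_natS_le k : ln k.+2%:R - ln k.+1%:R <= k.+1%:R^-1 :> R.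
Proof.
rewrite -ln_div ?posrE ?ltr0n//; apply: le_trans (ln_le_subr1 _) _.
  by rewrite divr_gt0 ?ltr0n.
by rewrite -[k.+2%:R]natr1 mulrDl divff ?pnatr_eq0// mul1r addrC addKr.
Qed.

Lemma ln_natS_ge k : k.+2%:R^-1 <= ln k.+2%:R - ln k.+1%:R :> R.
Proof.
rewrite -lerN2 opprB -ln_div ?posrE ?ltr0n//; apply: le_trans (ln_le_subr1 _) _.
  by rewrite divr_gt0 ?ltr0n.
have -> : k.+1%:R = k.+2%:R - 1 :> R by rewrite -[k.+2%:R]natr1 addrK.
by rewrite mulrBl divff ?pnatr_eq0// mul1r addrC addKr.
Qed.

Lemma landau_constS n : landau_const R n.+1 = landau_const R n + c n.+1 ^+ 2.
Proof. exact: big_ord_recr. Qed.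

Lemma landau_const_ge n : ln n.+2%:R / pi <= landau_const R n.
Proof.
have p0 := pi_gt0 R.
elim: n => [|n IH].
  rewrite /landau_const big_ord1 isqrt_coef0 expr1n ler_pdivrMr// mul1r.
  by have := pi_ge2 R; have := @ln_sublinear R 2%:R (ltr0n _ 2); lra.
rewrite landau_constS.
have := ln_natS_le n.+1; have := isqrt_coef_sqr_ge n.+1.
rewrite invfM mul1r mulrC -ler_pdivlMr ?invr_gt0// invrK => h1 h2.
move: IH; rewrite !ler_pdivrMr// mulrDl => IH.
by rewrite -[leLHS](subrK (ln n.+2%:R)) addrC lerD// (le_trans h2 h1).
Qed.

Lemma landau_const_le n : landau_const R n.+1 <= 2 + ln n.+1%:R / pi.
Proof.
have p0 := pi_gt0 R.
elim: n => [|n IH].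
  rewrite landau_constS ln1 mul0r addr0 /landau_const big_ord1 isqrt_coef0 expr1n.
  rewrite -[leRHS]/(1 + 1) lerD2l exprn_ile1 ?(ltW (isqrt_coef_gt0 _ _))//.
  by rewrite -[leRHS](isqrt_coef0 R) isqrt_coefS_le.
rewrite landau_constS.
have := ln_natS_ge n; have := isqrt_coef_sqr_le n.+1.
rewrite invfM mul1r mulrC -ler_pdivrMr ?invr_gt0// invrK => h1 h2.
have : c n.+2 ^+ 2 <= (ln n.+2%:R - ln n.+1%:R) / pi.
  by rewrite ler_pdivlMr// (le_trans h1 h2).
lra.
Qed.
End Wallis.

(** * The asymptotic formula *)

Theorem corollary2p3 (R : realType) (c1 c2 : R) (hc1 : 0 < c1)
    (hc12 : c1 <= c2) :
  exists (C : R) (d0 : nat),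
    [/\ 0 < C,
        (3 <= d0)%N &
        forall d n : nat,
          (d0 <= d)%N -> (n < d)%N ->
          c1 * (d%:R / ln d%:R) <= n%:R ->
          n%:R <= c2 * (d%:R / ln d%:R) ->
          `|max_partial_sum R n d - ln d%:R / pi| <= C * ln (ln d%:R)].
Proof.
have c2_gt0 : 0 < c2 by exact: lt_le_trans hc12.
(* The upper bound exceeds L / pi by at most 2, and the lower bound falls short
   of it by at most l + |ln c1| + 6 c2, where L = ln d and l = ln L. *)
pose K := 2 + `|ln c1| + 6 * c2.
have K0 : 0 < K by rewrite /K; have := normr_ge0 (ln c1); lra.
(* From exp (exp 1) on, l >= 1, which absorbs constants into multiples of l. *)
exists (1 + K), (maxn 3 (Num.bound (expR (expR 1) : R))); split.
- by rewrite ltr_wpDl.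
- exact: leq_maxl.
move=> d n; rewrite geq_max => /andP[d3 dE] nd n_ge n_le.
have d_gt0 : 0 < d%:R :> R by rewrite ltr0n (leq_trans _ d3).
set L := ln d%:R; set l := ln L.
have LE : expR 1 <= L.
  rewrite -ler_expR lnK ?posrE//; apply: ltW.
  by apply: lt_le_trans (unstable.ltr_bound _) _; rewrite ler_nat.
have L1 : 1 <= L by have := expR_ge1Dx (1 : R); lra.
have L0 : 0 < L by exact: lt_le_trans L1.
have l1 : 1 <= l by rewrite -ler_expR lnK ?posrE.
have n0 : 0 < n%:R :> R.
  by apply: lt_le_trans n_ge; rewrite mulr_gt0 ?divr_gt0.
have lnn_ge : ln c1 + L - l <= ln n%:R.
  rewrite -addrA -ln_div ?posrE// -lnM ?posrE ?divr_gt0//.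
  by rewrite ler_ln ?posrE// mulr_gt0 ?divr_gt0.
have lnn_le : ln n%:R <= L by rewrite ler_ln ?posrE// ler_nat ltnW.
have p2 := pi_ge2 R.
have p0 : 0 < pi :> R by exact: pi_gt0.
set G := landau_const R n.
have G_ge : L / pi - l - `|ln c1| <= G.
  have h : ln n%:R / pi <= G.
    apply: le_trans (landau_const_ge _ _); rewrite ler_pM2r ?invr_gt0//.
    by rewrite ler_ln ?posrE ?n0 ?ltr0n// ler_nat -addn2 leq_addr.
  apply: le_trans h; rewrite ler_pdivlMr//.
  have -> : (L / pi - l - `|ln c1|) * pi = L - (l + `|ln c1|) * pi.
    by rewrite !mulrBl divfK ?gt_eqF// mulrDl opprD addrA.
  have := ler_norm (- ln c1); rewrite normrN.
  have := normr_ge0 (ln c1); nra.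
have G_le : G <= 2 + L / pi.
  move: n0 lnn_le @G G_ge.
  case: n {nd n_ge n_le lnn_ge} => [|n]; first by rewrite ltxx.
  move=> _ h G _; apply: le_trans (landau_const_le _ _) _.
  by rewrite lerD2l ler_pM2r ?invr_gt0.
have G_le3 : G <= 3 * L.
  apply: le_trans G_le _; have : L / pi <= L; last by lra.
  by rewrite ler_pdivrMr// ler_peMr; lra.
set t := n%:R / d%:R : R.
have t0 : 0 <= t by rewrite divr_ge0 ?ltW.
have tL : t * L <= c2.
  move: n_le; rewrite mulrA ler_pdivlMr// -/L => h.
  by rewrite /t mulrAC ler_pdivrMr.
have tG : t * G <= 3 * c2.
  have := ler_wpM2l t0 G_le3; lra.
have /andP[] := max_partial_sum_bounds R nd.
rewrite -/G -[2 * n%:R / d%:R]mulrA -/t => M_ge M_le.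
rewrite ler_norml; apply/andP.
have K1 : l + K <= (1 + K) * l.
  by rewrite mulrDl mul1r lerD2l ler_peMr// ltW.
rewrite /K in K1 *; have := normr_ge0 (ln c1).
split; lra.
Qed.
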